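(* Let $\mathcal A$ be a separable real Banach space and $\mathcal B=\mathcal A'$ its dual, with weak\* topology $w^*$. Let $\Theta$ be a parameter set, $\theta\mapsto f_\theta\in\mathcal B$ a parametric model, $C:\Theta\to[0,+\infty)$ a parameter cost, $R_\Theta:\mathcal B\to[0,+\infty]$ the parametric representation cost, $R$ its $w^*$-l.s.c. regularization, and $\mathcal F=\{f\in\mathcal B:R(f)<+\infty\}$. Let $q>0$ and $0<p\le1$. Assume that $R_\Theta=Q_\Theta^q$, where $Q_\Theta:\mathcal B\to[0,+\infty]$ is subadditive and absolutely $p$-homogeneous. Let $\mathcal N\subset\ker(R_\Theta):=\{f:R_\Theta(f)=0\}$ be a $w^*$-complemented subspace of $\mathcal B$, and suppose that $R_\Theta$ is coercive modulo $\mathcal N$. Let $P_{\mathcal N}:\mathcal B\to\mathcal B$ be any $w^*$-$w^*$-continuous linear projector onto $\mathcal N$. Then $\mathcal F$ is a quasi-Banach space under the quasi-norm $$\|f\|_{\mathcal F}:=\max\{R(f)^{1/(pq)},\ \|P_{\mathcal N}f\|_{\mathcal B}\},\qquad f\in\mathcal F.$$ More precisely, $\|\cdot\|_{\mathcal F}$ is a $p$-norm. When $p=1$, $\mathcal F$ is a Banach space.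
   Context: **Representation cost.** $w^*=\sigma(\mathcal B,\mathcal A)$. $\mathcal F_\Theta=\{f_\theta:\theta\in\Theta\}$. $R_\Theta(f)=\inf\{C(\theta):\theta\in\Theta,\ f_\theta=f\}$ for $f\in\mathcal F_\Theta$ and $R_\Theta(f)=+\infty$ for $f\in\mathcal B\setminus\mathcal F_\Theta$. A function $K:\mathcal B\to[-\infty,+\infty]$ is $w^*$-l.s.c. if all sublevel sets $\{K\le\alpha\}$, $\alpha\in\mathbb R$, are $w^*$-closed; its $w^*$-l.s.c. regularization is the largest $w^*$-l.s.c. function bounded above by $K$. **Properties of functions $K:\mathcal B\to[0,+\infty]$.** Subadditive: $K(f+g)\le K(f)+K(g)$. Absolutely $p$-homogeneous: $K(0)=0$ and $K(\alpha f)=|\alpha|^pK(f)$ for all $\alpha\in\mathbb R\setminus\{0\}$, $f\in\mathcal B$. Coercive modulo a subspace $\mathcal N$: for every $\alpha\in\mathbb R$ there is $\beta>0$ such that $K(f)\le\alpha$ implies $\inf_{g\in\mathcal N}\|f+g\|_{\mathcal B}\le\beta$. **Complemented subspaces.** A $w^*$-closed subspace $\mathcal N\subset\mathcal B$ is $w^*$-complemented if there are a $w^*$-closed subspace $\mathcal M\subset\mathcal B$ and $w^*$-$w^*$-continuous linear projectors $P_{\mathcal N},P_{\mathcal M}:\mathcal B\to\mathcal B$ with ranges $\mathcal N$, $\mathcal M$ and $P_{\mathcal N}+P_{\mathcal M}=\mathrm{Id}$. **Quasi-norms.** A quasi-norm $Q$ on a real vector space is a $[0,\infty)$-valued absolutely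 $1$-homogeneous function with $Q(f+g)\le c(Q(f)+Q(g))$ for some constant $c$, and $Q(f)=0\Rightarrow f=0$. For $0<p\le1$, it is a $p$-norm if moreover $Q(f+g)^p\le Q(f)^p+Q(g)^p$. Quasi-Banach means complete quasi-normed. *)

(* Defs.v *)
From HB Require Import structures.
From mathcomp Require Import all_boot all_order all_algebra.
From mathcomp Require Import all_classical all_reals all_analysis.

Set Implicit Arguments.
Unset Strict Implicit.
Unset Printing Implicit Defensive.

Import Order.TTheory GRing.Theory Num.Theory.
Import numFieldNormedType.Exports.

Local Open Scope classical_set_scope.
Local Open Scope ring_scope.

Definition separable (T : topologicalType) : Prop :=
  exists2 S : set T, countable S & dense S.

(* The library has no dual space.  [cdual A] is the submodule of [A -> R]
   consisting of the continuous linear functionals, with the operator norm. *)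
Section ContinuousDual.
Context {R : realType} (A : normedModType R).

Definition continuous_functional : {pred A -> R^o} :=
  fun f => `[< linear f /\ continuous f >].

Lemma continuous_functional_submod_closed :
  submod_closed continuous_functional.
Proof.
split.
  apply/asboolP; split; first by move=> a u v; rewrite scaler0 addr0.
  by move=> x; exact: cvg_cst.
move=> a f g /asboolP[lf cf] /asboolP[lg cg]; apply/asboolP; split.
  move=> b u v; rewrite [LHS](_ : _ = a *: f (b *: u + v) + g (b *: u + v))//.
  rewrite [RHS](_ : _ = b *: (a *: f u + g u) + (a *: f v + g v))//.
  rewrite lf lg !scalerDr !scalerA (mulrC a) -!addrA; congr (_ + _).
  by rewrite addrCA.
by move=> x; apply: cvgD; [apply: cvgZl_tmp; exact: cf|exact: cg].
Qed.

HB.instance Definition _ := GRing.isSubmodClosed.Build R (A -> R^o)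
  continuous_functional continuous_functional_submod_closed.

Record cdual := CDual {
  cdual_fun :> A -> R^o;
  cdualP : cdual_fun \in continuous_functional }.

HB.instance Definition _ := [isSub of cdual for cdual_fun].
HB.instance Definition _ := [Choice of cdual by <:].
HB.instance Definition _ := [SubChoice_isSubLmodule of cdual by <:].

Lemma cdual_linear (f : cdual) : linear f.
Proof. by have /asboolP[] := cdualP f. Qed.

Lemma cdual_continuous (f : cdual) : continuous f.
Proof. by have /asboolP[] := cdualP f. Qed.

HB.instance Definition _ (f : cdual) :=
  GRing.isLinear.Build R A R^o *:%R f (cdual_linear f).

Lemma cdualD (f g : cdual) x : (f + g) x = f x + g x. Proof. by []. Qed.

Lemma cdualZ a (f : cdual) x : (a *: f) x = a * f x. Proof. by []. Qed.

Definition cdual_norm (f : cdual) : R :=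
  sup [set `|f x| | x in [set x : A | `|x| <= 1]].

Lemma cdual_norm_has_sup (f : cdual) :
  has_sup [set `|f x| | x in [set x : A | `|x| <= 1]].
Proof.
split; first by exists `|f 0|; exists 0 => //=; rewrite normr0.
have [M fM] : exists M, forall x : A, `|x| <= 1 -> `|f x| <= M.
  apply: ((bounded_funP f).2 _ 1); apply/linear_bounded_continuous.
  exact: (@cdual_continuous f).
by exists M => _ [x /= x1 <-]; exact: fM.
Qed.

Lemma cdual_norm_le1 (f : cdual) x : `|x| <= 1 -> `|f x| <= cdual_norm f.
Proof.
move=> x1; apply: ub_le_sup; first by have [] := cdual_norm_has_sup f.
by exists x.
Qed.

Lemma cdual_normP (f : cdual) (x : A) : `|f x| <= cdual_norm f * `|x|.
Proof.
have [->|x0] := eqVneq x 0; first by rewrite linear0 !normr0 mulr0.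
have nx0 : 0 < `|x| by rewrite normr_gt0.
have := @cdual_norm_le1 f (`|x|^-1 *: x).
rewrite normrZ ger0_norm ?invr_ge0// mulVf ?gt_eqF// => /(_ (lexx _)).
rewrite linearZ/= normrZ ger0_norm ?invr_ge0//.
by rewrite ler_pdivrMl// mulrC.
Qed.

Lemma cdual_norm_le (f : cdual) M :
  (forall x, `|x| <= 1 -> `|f x| <= M) -> cdual_norm f <= M.
Proof.
move=> fM; apply: ge_sup; first by have [] := cdual_norm_has_sup f.
by move=> _ [x /= x1 <-]; exact: fM.
Qed.

Lemma cdual_norm_ge0 (f : cdual) : 0 <= cdual_norm f.
Proof.
by apply: (le_trans (normr_ge0 (f 0))); apply: cdual_norm_le1; rewrite normr0.
Qed.

Lemma cdual_normD (f g : cdual) :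
  cdual_norm (f + g) <= cdual_norm f + cdual_norm g.
Proof.
apply: cdual_norm_le => x x1; rewrite cdualD (le_trans (ler_normD _ _))//.
by rewrite lerD// cdual_norm_le1.
Qed.

Let cdual_normZ_le (a : R) (f : cdual) :
  cdual_norm (a *: f) <= `|a| * cdual_norm f.
Proof.
apply: cdual_norm_le => x x1.
by rewrite cdualZ normrM ler_wpM2l// cdual_norm_le1.
Qed.

Lemma cdual_normZ (a : R) (f : cdual) :
  cdual_norm (a *: f) = `|a| * cdual_norm f.
Proof.
apply/eqP; rewrite eq_le cdual_normZ_le/=.
have [->|a0] := eqVneq a 0; first by rewrite normr0 mul0r cdual_norm_ge0.
rewrite -ler_pdivlMl ?normr_gt0// -normfV.
by rewrite -{1}[f](scalerK a0) cdual_normZ_le.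
Qed.

Lemma cdual_norm0_eq0 (f : cdual) : cdual_norm f = 0 -> f = 0.
Proof.
move=> f0; apply/val_inj/funext => x; apply/eqP; rewrite -normr_le0.
by rewrite (le_trans (cdual_normP f x))// f0 mul0r.
Qed.

HB.instance Definition _ := @Lmodule_isNormed.Build R cdual
  cdual_norm cdual_normD cdual_normZ cdual_norm0_eq0.

(* [wstar] is [cdual] with the topology of pointwise convergence on [A]
   instead of the norm topology. *)
Definition wstar : Type := cdual.

HB.instance Definition _ := GRing.Lmodule.on wstar.
HB.instance Definition _ := Topological.copy wstar
  (initial_topology (cdual_fun : cdual -> {ptws A -> R^o})).

Lemma wstar_eval_continuous (x : A) :
  continuous ((fun f : cdual => f x) : wstar -> R^o).
Proof.
move=> f; apply: (@continuous_comp wstar {ptws A -> R^o} R^o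
  (cdual_fun : wstar -> {ptws A -> R^o}) (fun g => g x)).
  exact: initial_continuous.
exact: (@proj_continuous A (fun _ => R^o : topologicalType)).
Qed.

Definition wstar_closed (S : set cdual) : Prop := closed (S : set wstar).

Definition wstar_continuous (P : cdual -> cdual) : Prop :=
  continuous (P : wstar -> wstar).

End ContinuousDual.

Section RepresentationCost.
Context {R : realType} {A : normedModType R}.
Local Notation B := (cdual A).
Implicit Types K : B -> \bar R.
Local Open Scope ereal_scope.

(* [ereal_inf set0 = +oo] gives the value outside the range of the model. *)
Definition repr_cost (Theta : Type) (model : Theta -> B) (C : Theta -> R)
    (f : B) : \bar R :=
  ereal_inf [set (C t)%:E | t in [set t | model t = f]].

Lemma repr_cost_notin (Theta : Type) (model : Theta -> B) (C : Theta -> R) f :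
  ~ range model f -> repr_cost model C f = +oo.
Proof.
move=> Nf; rewrite /repr_cost [X in ereal_inf X](_ : _ = set0) ?ereal_inf0//.
by rewrite -subset0 => _ [t /= tf _]; apply: Nf; exists t.
Qed.

Definition wstar_lsc K : Prop :=
  forall a : R, wstar_closed [set f | K f <= a%:E].

Lemma wstar_lscP K :
  wstar_lsc K <-> lower_semicontinuous (K : wstar A -> \bar R).
Proof.
rewrite lower_semicontinuousP; split=> H a; have := H a.
  rewrite /wstar_closed -openC; congr open; apply/seteqP.
  by split=> f /=; rewrite ltNge => /negP.
rewrite -closedC /wstar_closed; congr closed; apply/seteqP.
by split=> f /=; rewrite leNgt => /negP.
Qed.

Definition lsc_reg K (f : B) : \bar R :=
  ereal_sup [set H f | H in [set H | wstar_lsc H /\ forall g, H g <= K g]].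

Lemma lsc_reg_lsc K : wstar_lsc (lsc_reg K).
Proof.
move=> a; pose D := [set H | wstar_lsc H /\ forall g, H g <= K g].
rewrite [X in wstar_closed X](_ : _ = \bigcap_(H in D) [set f | H f <= a%:E]).
  by apply: closed_bigI => H [+ _]; exact.
apply/seteqP; split=> f /= fa.
  by move=> H DH; apply: le_trans fa; apply: ereal_sup_ubound; exists H.
by apply: ge_ereal_sup => _ [H DH <-]; exact: fa.
Qed.

Lemma lsc_reg_le K f : lsc_reg K f <= K f.
Proof. by apply: ge_ereal_sup => _ [H [_ HK] <-]. Qed.

Lemma lsc_reg_max K H : wstar_lsc H -> (forall f, H f <= K f) ->
  forall f, H f <= lsc_reg K f.
Proof. by move=> lH HK f; apply: ereal_sup_ubound; exists H. Qed.

Lemma lsc_reg_ge0 K : (forall f, 0 <= K f) -> forall f, 0 <= lsc_reg K f.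
Proof.
move=> K0; apply: (@lsc_reg_max K (cst 0)) => // a.
have [a0|a0] := leP 0%R a.
  rewrite [X in wstar_closed X](_ : _ = setT); first exact: closedT.
  by apply/seteqP; split=> f //=; rewrite lee_fin.
rewrite [X in wstar_closed X](_ : _ = set0); first exact: closed0.
by rewrite -subset0 => f /=; rewrite lee_fin leNgt a0.
Qed.

Definition coercive_modulo (N : set B) K : Prop :=
  forall a : R, exists2 b : R, (0 < b)%R &
    forall f, K f <= a%:E -> (inf [set `|f + g| | g in N] <= b)%R.

End RepresentationCost.

Section HomogeneousFunctions.
Context {R : realType} {V : lmodType R}.
Local Open Scope ereal_scope.

Definition subadditive_fun (K : V -> \bar R) : Prop :=
  forall f g, K (f + g)%R <= K f + K g.

Definition abs_homogeneous (p : R) (K : V -> \bar R) : Prop :=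
  K 0%R = 0 /\
  forall a f, a != 0%R -> K (a *: f)%R = (`|a| `^ p)%:E * K f.

End HomogeneousFunctions.

Section Complemented.
Context {R : realType} {A : normedModType R}.
Local Notation B := (cdual A).

Definition wstar_projector (N : set B) (P : B -> B) : Prop :=
  [/\ linear P, wstar_continuous P, forall f, P (P f) = P f & range P = N].

Definition wstar_complemented (N : set B) : Prop :=
  [/\ submod_closed (mem N), wstar_closed N &
    exists (M : set B) (PN PM : B -> B),
      [/\ submod_closed (mem M), wstar_closed M, wstar_projector N PN,
          wstar_projector M PM & forall f, PN f + PM f = f]].

End Complemented.

(* [F] is a linear subspace of [V]; only the values of [nF] on [F] matter. *)
Section QuasiNorms.
Context {R : realType} {V : lmodType R}.
Implicit Types (F : set V) (nF : V -> R).

Definition quasi_norm F nF : Prop :=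
  [/\ forall f, F f -> 0 <= nF f,
      nF 0 = 0 /\ (forall a f, F f -> a != 0 -> nF (a *: f) = `|a| * nF f),
      (exists c : R, forall f g, F f -> F g -> nF (f + g) <= c * (nF f + nF g))
    & forall f, F f -> nF f = 0 -> f = 0].

Definition p_norm (p : R) F nF : Prop :=
  quasi_norm F nF /\
  forall f g, F f -> F g -> nF (f + g) `^ p <= nF f `^ p + nF g `^ p.

(* A quasi-norm induces a metrizable uniformity, hence sequences suffice. *)
Definition complete_wrt F nF : Prop :=
  forall u : nat -> V, (forall n, F (u n)) ->
    (forall e : R, 0 < e -> exists n0 : nat, forall m n : nat,
      (n0 <= m)%N -> (n0 <= n)%N -> nF (u m - u n) < e) ->
    exists2 f, F f & (fun n => nF (u n - f)) @ \oo --> (0 : R).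

Definition quasi_banach F nF : Prop :=
  [/\ submod_closed (mem F), quasi_norm F nF & complete_wrt F nF].

(* [(F, nF)] is, up to a linear isometry, a Banach space of the library. *)
Definition banach F nF : Prop :=
  exists (E : completeNormedModType R) (i : {linear E -> V}),
    [/\ injective i, range i = F & forall x, nF (i x) = `|x|].

End QuasiNorms.

(* Main.v *)
(* The regularization of Q^q is S^q, where S is the weak* l.s.c. regularization
   of Q, and S inherits subadditivity and absolute p-homogeneity from Q.  A
   weak*-weak* continuous projector is norm bounded (uniform boundedness), so
   coercivity modulo N bounds |f - P f| on {Q <= 2}; as this bound is a weak*
   closed condition it holds on {S <= 1}, and by homogeneity
   |f - P f| <= c * S(f)^(1/p).  Hence |f| <= (1 + c) |f|_F, which gives
   definiteness and turns |.|_F-Cauchy sequences into norm Cauchy ones.  These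
   converge weak*, and completeness follows because the balls of |.|_F are
   weak* closed. *)
From HB Require Import structures.
Require Import Defs.
From mathcomp Require Import all_boot all_order all_algebra.
From mathcomp Require Import all_classical all_reals all_analysis.

Set Implicit Arguments.
Unset Strict Implicit.
Unset Printing Implicit Defensive.

Import Order.TTheory GRing.Theory Num.Theory.
Import numFieldNormedType.Exports.

Local Open Scope classical_set_scope.
Local Open Scope ring_scope.

(** * Weak* convergence, weak* closed sets and limits of Cauchy sequences in the dual *)

Section WeakStarTopology.
Context {R : realType} {A : normedModType R}.
Local Notation B := (cdual A).

Lemma wstar_cvgP (F : set_system B) (f : B) (FF : Filter F) :
  (F : set_system (wstar A)) --> (f : wstar A) <->
  forall x : A, (fun g : B => g x : R^o) @ F --> (f x : R^o).
Proof.
split=> [Ff x|Ff].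
  by apply: cvg_trans (@wstar_eval_continuous R A x f) => V /= /Ff.
move=> V; rewrite nbhsE /= => -[U [[W openW <-] Wf] WV].
apply: filterS WV _; have /pointwise_cvgP cF :
    forall x, (fun g : A -> R^o => g x) @ (@cdual_fun R A @ F) --> (f x : R^o).
  by move=> x; exact: Ff.
by apply: (cF); exact: open_nbhs_nbhs.
Qed.

(** Weak* convergence is pointwise convergence on [A], so evaluations suffice as tests;
    translations, dilations and [f - P f] then reduce to scalar limit rules. *)
Lemma wstar_continuousP (h : B -> B) : wstar_continuous h <->
  forall x : A, continuous ((fun f : B => h f x) : wstar A -> R^o).
Proof.
split=> [ch x f|ch f].
  by apply: (@continuous_comp (wstar A) (wstar A) R^o h (fun g : B => g x));
    [exact: ch | exact: wstar_eval_continuous].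
have FF := nbhs_filter (f : wstar A).
apply/(wstar_cvgP (h f) (fmap_filter (h : wstar A -> B) FF)) => x.
exact: ch.
Qed.

Lemma wstar_continuous_translation (g : B) :
  wstar_continuous (fun f : B => f + g).
Proof.
apply/wstar_continuousP => x f.
have -> : (fun h : B => (h + g) x) = (fun h : B => h x + g x :> R^o) by [].
have FF := nbhs_filter (f : wstar A).
by apply: cvgD; [exact: wstar_eval_continuous | exact: cvg_cst].
Qed.

Lemma wstar_continuous_scale (a : R) : wstar_continuous (fun f : B => a *: f).
Proof.
apply/wstar_continuousP => x f.
have -> : (fun h : B => (a *: h) x) = (fun h : B => a *: (h x : R^o)) by [].
have FF := nbhs_filter (f : wstar A).
by apply: cvgZl_tmp; exact: wstar_eval_continuous.
Qed.

Lemma cdual_eval_continuous (x : A) :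
  continuous ((fun f : B => f x) : B -> R^o).
Proof.
have lx : linear ((fun f : B => f x) : B -> R^o) by [].
pose xL : {linear B -> R^o} :=
  HB.pack ((fun f : B => f x) : B -> R^o) (GRing.isLinear.Build _ _ _ _ _ lx).
apply: (linear_bounded_continuous xL).1; apply: (bounded_funP xL).1 => r.
exists (r * `|x|) => f fr; apply: le_trans (cdual_normP f x) _.
exact: ler_wpM2r.
Qed.

Lemma wstar_closed_preimage (h : B -> B) (D : set B) :
  wstar_continuous h -> wstar_closed D -> wstar_closed (h @^-1` D).
Proof. by move=> /continuous_closedP; apply. Qed.

(** The dual norm is a supremum of the weak* continuous functions [|f x|], so its balls are
    intersections of weak* closed sets. *)
Lemma wstar_closed_ball (M : R) : wstar_closed [set f : B | `|f| <= M].
Proof.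
rewrite [X in wstar_closed X](_ : _ =
  \bigcap_(x in [set x : A | `|x| <= 1]) [set f : B | `|f x| <= M]).
  apply: closed_bigI => x _.
  have /continuous_closedP := @wstar_eval_continuous R A x.
  move=> /(_ [set y | `|y| <= M]); apply.
  have /continuous_closedP := @norm_continuous R R^o.
  by move=> /(_ [set y | y <= M]); apply; exact: closed_le.
apply/seteqP; split=> f /= fM.
  by move=> x /= x1; apply: le_trans fM; exact: cdual_norm_le1.
by apply: cdual_norm_le => x x1; exact: fM.
Qed.

Lemma wstar_closed_cvg (D : set B) (u : nat -> B) (f : B) :
  wstar_closed D -> (forall x : A, u n x @[n --> \oo] --> (f x : R^o)) ->
  (\forall n \near \oo, D (u n)) -> D f.
Proof.
move=> cD uf Du; apply: (@closed_cvg nat (wstar A) (\oo) _ u D cD Du f).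
exact/(wstar_cvgP f (fmap_filter u _)).
Qed.

(** Scalar limits exist at each [x], and linearity and boundedness pass to them. Pointwise
    convergence is enough here: later bounds reach the limit through weak* closed sets. *)
Lemma cdual_cauchy_cvg (u : nat -> B) :
  (forall e : R, 0 < e -> exists n0 : nat, forall m n : nat,
    (n0 <= m)%N -> (n0 <= n)%N -> `|u m - u n| <= e) ->
  exists f : B, forall x : A, u n x @[n --> \oo] --> (f x : R^o).
Proof.
move=> uC.
have cux (x : A) : cvg (((fun n => u n x) : nat -> R^o) @ \oo).
  apply/cauchy_cvgP/cauchy_exP => e e0.
  (* Adding 1 keeps the divisor positive when [x = 0]. *)
  have x1 : 0 < `|x| + 1 by rewrite ltr_wpDl.
  have [n0 n0P] := uC (e / 2 / (`|x| + 1)) ltac:(by rewrite !divr_gt0).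
  exists (u n0 x); exists n0 => //= n n0n; rewrite -ball_normE /=.
  rewrite [X in `|X|](_ : _ = (u n0 - u n) x)//.
  apply: le_lt_trans (cdual_normP _ _) _.
  apply: (@le_lt_trans _ _ (e / 2 / (`|x| + 1) * (`|x| + 1))).
    by apply: ler_pM; rewrite ?n0P ?lerDl ?cdual_norm_ge0.
  by rewrite divfK ?gt_eqF// ltr_pdivrMr// ltr_pMr// ltr1n.
pose f (x : A) : R^o := lim ((u n x : R^o) @[n --> \oo]).
have uf x : u n x @[n --> \oo] --> (f x : R^o) by exact: cux.
have lf : linear f.
  move=> a x y; apply: cvg_lim => //.
  under eq_fun do rewrite linearP.
  by apply: cvgD; [apply: cvgZl_tmp; exact: uf | exact: uf].
have cf : continuous f.
  pose fL : {linear A -> R^o} := HB.pack f (GRing.isLinear.Build _ _ _ _ f lf).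
  (* From [n0] on, every [u n] has norm at most [1 + |u n0|], a bound that [f] inherits. *)
  have [n0 n0P] := uC 1 ltr01.
  apply: (linear_bounded_continuous fL).1; apply: (bounded_funP fL).1 => r.
  exists ((1 + `|u n0|) * r) => x xr; rewrite /fL/=.
  apply: (@closed_cvg nat R^o (\oo) _ (fun n => u n x)
    [set y | `|y| <= (1 + `|u n0|) * r]) (uf x) => /=.
    have /continuous_closedP := @norm_continuous R R^o.
    by move=> /(_ [set y | y <= (1 + `|u n0|) * r]); apply; exact: closed_le.
  exists n0 => //= n n0n; apply: le_trans (cdual_normP (u n) x) _.
  apply: ler_pM => //; first exact: cdual_norm_ge0.
  rewrite -(subrK (u n0) (u n)); apply: le_trans (cdual_normD _ _) _.
  by rewrite lerD2r n0P.
have fP : f \in @continuous_functional R A by apply/asboolP.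
by exists (CDual fP).
Qed.

End WeakStarTopology.

(** Uniform boundedness on the complete space [A], applied to the functionals [T f] with
    [|f| <= 1]. *)
Lemma wstar_continuous_linear_bounded (R : realType)
    (A : completeNormedModType R) (T : {linear cdual A -> cdual A}) :
  wstar_continuous T ->
  exists2 M : R, 0 < M & forall f, `|T f| <= M * `|f|.
Proof.
move=> cT.
pose ball_image := [set (T f : A -> R^o) | f in [set f | `|f| <= 1]].
have [||M MP] := @Banach_Steinhauss R A R^o ball_image _ _ 1; last first.
- exists (`|M| + 1) => [|f]; first by rewrite ltr_wpDl.
  have [->|f0] := eqVneq f 0; first by rewrite linear0 !normr0 mulr0.
  have nf0 : 0 < `|f| by rewrite normr_gt0.
  rewrite -ler_pdivrMr// mulrC -[X in X * _]gtr0_norm ?invr_gt0// -normrZ.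
  rewrite -[X in `|X|]linearZ.
  apply: (@le_trans _ _ `|M|); last by rewrite lerDl.
  apply: cdual_norm_le => x x1; apply: le_trans (ler_norm M).
  apply: MP => //; exists (`|f|^-1 *: f) => //=.
  by rewrite normrZ ger0_norm ?invr_ge0// mulVf ?gt_eqF.
(* For fixed [x], [T f x] is weak* continuous in [f], hence norm continuous because norm convergence
   implies weak* convergence; so it is bounded on the unit ball. *)
- move=> x; have lTx : linear ((fun f => T f x) : cdual A -> R^o).
    by move=> a f g; rewrite linearP.
  pose TxL : {linear cdual A -> R^o} :=
    HB.pack ((fun f => T f x) : cdual A -> R^o)
      (GRing.isLinear.Build _ _ _ _ _ lTx).
  have cTx : continuous TxL.
    move=> f; have TW := (wstar_continuousP T).1 cT x f.
    apply: cvg_trans TW => V /= WV.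
    by apply: (wstar_cvgP f (nbhs_filter f)).2 WV => y;
      exact: cdual_eval_continuous.
  have /linear_bounded_continuous/bounded_funP/(_ 1) [M MP] := cTx.
  by exists M => _ [f f1 <-]; exact: MP.
- move=> _ [f /= f1 <-]; split; last exact: cdual_linear.
  by move=> r; exists (`|T f| * r) => x xr; apply: le_trans (cdual_normP _ _) _;
    apply: ler_wpM2l => //; exact: cdual_norm_ge0.
Qed.

(** * Stability of weak* lower semicontinuity and of the regularization *)

Section LscRegularization.
Context {R : realType} {A : normedModType R}.
Local Notation B := (cdual A).
Implicit Types K H : B -> \bar R.
Local Open Scope ereal_scope.

Lemma wstar_lsc_comp K (h : B -> B) :
  wstar_continuous h -> wstar_lsc K -> wstar_lsc (K \o h).
Proof. by move=> ch lK a; exact: (wstar_closed_preimage ch (lK a)). Qed.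

Lemma wstar_lscB K (c : R) : wstar_lsc K -> wstar_lsc (fun f => K f - c%:E).
Proof.
move=> lK a; have := lK (a + c)%R; congr (wstar_closed _).
by apply/seteqP; split=> f /=; rewrite EFinN leeBlDr// EFinD.
Qed.

Lemma wstar_lscZ K (c : R) :
  (0 < c)%R -> wstar_lsc K -> wstar_lsc (fun f => c%:E * K f).
Proof.
move=> c0 lK a; have := lK (c^-1 * a)%R; congr (wstar_closed _).
by apply/seteqP; split=> f /=; rewrite EFinM lee_pdivlMl.
Qed.

Lemma poweR_le_EFin (x : \bar R) (s t : R) :
  0 <= x -> (0 < s)%R -> (0 <= t)%R ->
  (x `^ s <= t%:E) = (x <= (t `^ s^-1)%:E).
Proof.
move=> x0 s0 t0; have s0' : (0 <= s^-1)%R by rewrite invr_ge0 ltW.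
have xK : (x `^ s) `^ s^-1 = x by rewrite -poweRrM mulfV ?gt_eqF// poweRe1.
have tK : t%:E = (t `^ s^-1)%:E `^ s.
  by rewrite poweR_EFin -powRrM mulVf ?gt_eqF// powRr1.
apply/idP/idP => [xt|xt].
  rewrite -xK -poweR_EFin; apply: gt0_ler_poweR => //.
    by rewrite in_itv /= poweR_ge0 leey.
  by rewrite in_itv /= lee_fin t0 leey.
rewrite tK; apply: gt0_ler_poweR => //; first exact: ltW.
  by rewrite in_itv /= x0 leey.
by rewrite in_itv /= lee_fin powR_ge0 leey.
Qed.

Lemma wstar_lsc_poweR K (s : R) : (0 < s)%R -> (forall f, 0 <= K f) ->
  wstar_lsc K -> wstar_lsc (fun f => K f `^ s).
Proof.
move=> s0 K0 lK a; have [a0|a0] := leP 0%R a.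
  have := lK (a `^ s^-1)%R; congr (wstar_closed _).
  by apply/seteqP; split=> f /=; rewrite poweR_le_EFin.
rewrite [X in wstar_closed X](_ : _ = set0); first exact: closed0.
rewrite -subset0 => f /= /(le_trans (poweR_ge0 _ _)).
by rewrite lee_fin leNgt a0.
Qed.

(** The [s]-th power is an increasing bijection of [[0, +oo]], so it carries l.s.c. minorants of [K]
    to those of the power, and its inverse carries them back; maximality is used once in each
    direction. *)
Lemma lsc_reg_poweR K (s : R) : (0 < s)%R -> (forall f, 0 <= K f) ->
  lsc_reg (fun f => K f `^ s) = fun f => lsc_reg K f `^ s.
Proof.
move=> s0 K0; have S0 := lsc_reg_ge0 K0.
have pK x : 0 <= x -> (x `^ s^-1) `^ s = x :> \bar R.
  by move=> x0; rewrite -poweRrM mulVf ?gt_eqF// poweRe1.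
have Kp x : 0 <= x -> (x `^ s) `^ s^-1 = x :> \bar R.
  by move=> x0; rewrite -poweRrM mulfV ?gt_eqF// poweRe1.
have le_pow x y t : (0 < t)%R -> 0 <= x -> x <= y -> x `^ t <= y `^ t :> \bar R.
  move=> t0 x0 xy; apply: gt0_ler_poweR => //; first exact: ltW.
    by rewrite in_itv /= x0 leey.
  by rewrite in_itv /= (le_trans x0 xy) leey.
have Ks0 f : 0 <= lsc_reg (fun g => K g `^ s) f.
  by apply: lsc_reg_ge0 => g; exact: poweR_ge0.
have si0 : (0 < s^-1)%R by rewrite invr_gt0.
apply/funext => f; apply/eqP; rewrite eq_le; apply/andP; split; last first.
  apply: (@lsc_reg_max _ _ _ (fun f => lsc_reg K f `^ s)) => [|g].
    by apply: wstar_lsc_poweR => //; exact: lsc_reg_lsc.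
  by apply: (le_pow) => //; exact: lsc_reg_le.
rewrite -[leLHS]pK//; apply: (le_pow) => //; first exact: poweR_ge0.
apply: (@lsc_reg_max _ _ _
  (fun f => lsc_reg (fun g => K g `^ s) f `^ s^-1)) => [|g].
  by apply: wstar_lsc_poweR => //; exact: lsc_reg_lsc.
rewrite -[leRHS]Kp//.
by apply: (le_pow) => //; exact: lsc_reg_le.
Qed.

(** For finite [x], [lsc_reg K (f + g) - x] is an l.s.c. minorant of [K] as a function of [f], hence
    lies below [lsc_reg K]. *)
Let lsc_reg_shift K (g : B) (x : \bar R) : (forall f, 0 <= K f) -> 0 <= x ->
  (forall f, lsc_reg K (f + g)%R <= K f + x) ->
  forall f, lsc_reg K (f + g)%R <= lsc_reg K f + x.
Proof.
move=> K0; case: x => [c| |]// c0 Kc f; last first.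
  by rewrite addey ?leey// gt_eqF// (lt_le_trans _ (lsc_reg_ge0 K0 f)).
rewrite -leeBlDr//.
apply: (@lsc_reg_max _ _ K (fun f => lsc_reg K (f + g)%R - c%:E)).
  apply: wstar_lscB.
  apply: (@wstar_lsc_comp (lsc_reg K) (fun f => f + g)%R).
    exact: wstar_continuous_translation.
  exact: lsc_reg_lsc.
by move=> h; rewrite leeBlDr.
Qed.

(* The universal property of the regularization is applied to one variable at a
   time, which avoids neighbourhood bases of the weak* topology. *)
Lemma lsc_reg_subadditive K : (forall f, 0 <= K f) ->
  subadditive_fun K -> subadditive_fun (lsc_reg K).
Proof.
move=> K0 sK f g; rewrite [in leLHS]addrC addeC.
apply: lsc_reg_shift => // [|h]; first exact: lsc_reg_ge0.
rewrite addrC addeC; apply: lsc_reg_shift => // k.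
exact: le_trans (lsc_reg_le _ _) (sK _ _).
Qed.

Lemma lsc_reg_homogeneous K (p : R) : (forall f, 0 <= K f) ->
  abs_homogeneous p K -> abs_homogeneous p (lsc_reg K).
Proof.
move=> K0 [K00 hK]; split.
  by apply/eqP; rewrite eq_le lsc_reg_ge0// andbT -K00 lsc_reg_le.
have powN0 (a : R) : a != 0%R -> (0 < `|a| `^ p)%R.
  by move=> a0; apply: powR_gt0; rewrite normr_gt0.
have le_hom (a : R) f : a != 0%R ->
    lsc_reg K (a *: f)%R <= (`|a| `^ p)%:E * lsc_reg K f.
  move=> a0; rewrite -lee_pdivrMl ?powN0//.
  apply: (@lsc_reg_max _ _ K
    (fun f => ((`|a| `^ p)^-1)%:E * lsc_reg K (a *: f)%R)).
    apply: wstar_lscZ; first by rewrite invr_gt0 powN0.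
    apply: (@wstar_lsc_comp (lsc_reg K) (fun f => a *: f)%R).
      exact: wstar_continuous_scale.
    exact: lsc_reg_lsc.
  by move=> g; rewrite lee_pdivrMl ?powN0// -hK// lsc_reg_le.
move=> a f a0; apply/eqP; rewrite eq_le le_hom//=.
(* The reverse inequality is [le_hom] for [a^-1] at the point [a *: f]. *)
rewrite -{1}[f](scalerK a0) -lee_pdivlMl ?powN0//.
apply: le_trans (le_hom _ _ _) _; first by rewrite invr_neq0.
by rewrite normfV -(powR_inv1 (normr_ge0 a)) -powRrM mulN1r powRN.
Qed.

Lemma lsc_reg_sublevel K (D : set B) (a : R) f : (0 <= a)%R ->
  (forall g, 0 <= K g) -> wstar_closed D -> (forall g, K g <= a%:E -> D g) ->
  lsc_reg K f < a%:E -> D f.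
Proof.
move=> a0 K0 cD KD; apply: contraPP => Df; apply/negP; rewrite -leNgt.
(* The sublevel sets of this two-valued function are empty, [D] or everything, so it is l.s.c.; it
   lies below [K] because [K > a] off [D]. Its value [a] off [D] is why the bound on [lsc_reg K f]
   has to be strict. *)
pose H g : \bar R := if `[< D g >] then 0 else a%:E.
suff : H f <= lsc_reg K f by rewrite /H asboolF.
apply: lsc_reg_max => [t|g]; last first.
  by rewrite /H; case: asboolP => // Dg; rewrite leNgt; apply/negP => /ltW/KD.
have [t0|t0] := ltP t 0%R.
  rewrite [X in wstar_closed X](_ : _ = set0); first exact: closed0.
  rewrite -subset0 => g /=; rewrite /H; case: ifP => _; rewrite lee_fin leNgt.
    by rewrite t0.
  by rewrite (lt_le_trans t0).
have [ta|ta] := ltP t a.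
  rewrite [X in wstar_closed X](_ : _ = D)//.
  apply/seteqP; split=> g /=; rewrite /H; case: asboolP => //.
  by rewrite lee_fin leNgt ta.
rewrite [X in wstar_closed X](_ : _ = setT); first exact: closedT.
by apply/seteqP; split=> g //= _; rewrite /H; case: ifP; rewrite lee_fin.
Qed.

End LscRegularization.

(** * Real powers and the triangle inequality of a [p]-norm *)

Section PowerSubadditivity.
Context {R : realType}.

Lemma powR_subadditive (p a b : R) : 0 < p -> p <= 1 -> 0 <= a -> 0 <= b ->
  (a + b) `^ p <= a `^ p + b `^ p.
Proof.
move=> p0 p1 a0 b0; have [s0|s0] := eqVneq (a + b) 0.
  by rewrite s0 powR0 ?gt_eqF// addr_ge0// powR_ge0.
have {}s0 : 0 < a + b by rewrite lt0r s0 addr_ge0.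
(* The ratio [x / (a + b)] lies in [[0, 1]] and [p <= 1], so it is at most its own [p]-th power; the
   instances [x = a] and [x = b] add up to the claim. *)
have le_pow x : 0 <= x -> x <= a + b -> x / (a + b) * (a + b) `^ p <= x `^ p.
  move=> x0 xs; have xs0 : 0 <= x / (a + b) by rewrite divr_ge0// ltW.
  rewrite -{2}(divfK (lt0r_neq0 s0) x) powRM// ?(ltW s0)//.
  apply: ler_wpM2r; first exact: powR_ge0.
  have [->|xn0] := eqVneq x 0; first by rewrite mul0r powR_ge0.
  by rewrite ger1_powR// ler_pdivrMr// mul1r xs divr_gt0// lt0r xn0.
have := lerD (le_pow a a0 _) (le_pow b b0 _).
rewrite -!mulrDl mulfV ?gt_eqF// mul1r; apply; first by rewrite lerDl.
by rewrite lerDr.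
Qed.

Lemma powRK (p x : R) : p != 0 -> 0 <= x -> (x `^ p) `^ p^-1 = x.
Proof. by move=> p0 x0; rewrite -powRrM mulfV// powRr1. Qed.

Lemma powRVK (p x : R) : p != 0 -> 0 <= x -> (x `^ p^-1) `^ p = x.
Proof. by move=> p0 x0; rewrite -powRrM mulVf// powRr1. Qed.

Lemma gt0_ler_powRl (p x y : R) : 0 < p -> 0 <= x -> x <= y -> x `^ p <= y `^ p.
Proof.
move=> p0 x0 xy; apply: ge0_ler_powR => //; first exact: ltW.
by rewrite nnegrE (le_trans x0).
Qed.

End PowerSubadditivity.

Lemma p_norm_intro (R : realType) (V : lmodType R) (p : R) (F : set V)
    (nF : V -> R) : 0 < p ->
  (forall f g, F f -> F g -> F (f + g)) ->
  (forall f, 0 <= nF f) -> nF 0 = 0 ->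
  (forall a f, F f -> a != 0 -> nF (a *: f) = `|a| * nF f) ->
  (forall f, F f -> nF f = 0 -> f = 0) ->
  (forall f g, F f -> F g -> nF (f + g) `^ p <= nF f `^ p + nF g `^ p) ->
  p_norm p F nF.
Proof.
move=> p0 FD n0 n00 nZ ndef nD; split=> //; split=> //.
(* Each of the two [p]-th powers is at most that of [nF f + nF g]; the factor 2 becomes this
   constant on taking roots. *)
exists (2 `^ p^-1) => f g Ff Fg.
have pn0 : p != 0 by rewrite gt_eqF.
have fg0 : 0 <= nF f + nF g by rewrite addr_ge0.
rewrite -[leLHS](@powRK _ p)// -[X in _ * X](@powRK _ p)// -powRM//; last first.
  exact: powR_ge0.
apply: gt0_ler_powRl; rewrite ?invr_gt0 ?powR_ge0//.
apply: le_trans (nD _ _ Ff Fg) _; rewrite mulr_natl mulr2n.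
by apply: lerD; apply: gt0_ler_powRl; rewrite ?lerDl ?lerDr.
Qed.

(** * The case [p = 1]: a complete normed subspace as a Banach space *)

Section NormedSubspace.
Context {R : realType} {V : lmodType R} {F : set V} {nF : V -> R}.

(* The proofs are parameters of the carrier so that the instances below can be
   inferred from it. *)
Definition subspace_pred (_ : quasi_banach F nF) (_ : p_norm 1 F nF) :
  {pred V} := mem F.

Context (qbF : quasi_banach F nF) (nF1 : p_norm 1 F nF).

Lemma subspace_pred_submod_closed : submod_closed (subspace_pred qbF nF1).
Proof. by case: qbF. Qed.

HB.instance Definition _ := GRing.isSubmodClosed.Build R V
  (subspace_pred qbF nF1) subspace_pred_submod_closed.

Record normed_subspace := NormedSubspace {
  subspace_val : V;
  subspace_valP : subspace_val \in subspace_pred qbF nF1 }.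

HB.instance Definition _ := [isSub of normed_subspace for subspace_val].
HB.instance Definition _ := [Choice of normed_subspace by <:].
HB.instance Definition _ := [SubChoice_isSubLmodule of normed_subspace by <:].

Definition subspace_norm (x : normed_subspace) : R := nF (val x).

Lemma subspace_valF (x : normed_subspace) : F (val x).
Proof. exact/set_mem/(subspace_valP x). Qed.

Lemma subspace_normD x y :
  subspace_norm (x + y) <= subspace_norm x + subspace_norm y.
Proof.
have [[n0 _ _ _] nD] := nF1; have := nD _ _ (subspace_valF x) (subspace_valF y).
rewrite !powRr1 ?n0//; [exact: subspace_valF|exact: subspace_valF|].
exact: (subspace_valF (x + y)).
Qed.

Lemma subspace_normZ a x : subspace_norm (a *: x) = `|a| * subspace_norm x.
Proof.
have [[_ [n0 nZ] _ _] _] := nF1.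
have [->|a0] := eqVneq a 0; first by rewrite scale0r normr0 mul0r.
exact: nZ (subspace_valF x) a0.
Qed.

Lemma subspace_norm0_eq0 x : subspace_norm x = 0 -> x = 0.
Proof.
have [[_ _ _ ndef] _] := nF1; move=> x0; apply/val_inj.
exact: ndef (subspace_valF x) x0.
Qed.

HB.instance Definition _ := @Lmodule_isNormed.Build R normed_subspace
  subspace_norm subspace_normD subspace_normZ subspace_norm0_eq0.

(** Sequences suffice: a Cauchy filter contains balls of radius [1 / (n + 1)], any two of which
    meet, so their centres form a Cauchy sequence; its limit is the limit of the filter. *)
Lemma subspace_complete (G : set_system normed_subspace) :
  ProperFilter G -> cauchy G -> cvg G.
Proof.
move=> GG /cauchyP Gc.
have xP n : exists x, G (ball x (n.+1%:R^-1 : R)).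
  by apply: Gc; rewrite invr_gt0.
have [x Gx] := choice xP.
have [_ _ /(_ (fun n => val (x n)))] := qbF; case.
- by move=> n; exact: subspace_valF.
- move=> e e0; have e20 : 0 < e / 2 by rewrite divr_gt0.
  have [n0 _ n0P] := near_infty_natSinv_lt (PosNum e20).
  exists n0 => m n mn nn.
  have [y [xmy xny]] : exists y, ball (x m) (m.+1%:R^-1 : R) y /\
      ball (x n) (n.+1%:R^-1 : R) y by exact: filter_ex (filterI (Gx m) (Gx n)).
  have := ball_triangle xmy (ball_sym xny); rewrite -ball_normE /= => xmn.
  by apply: lt_trans xmn _; rewrite [ltRHS](splitr e) ltrD//; exact: n0P.
move=> f Ff xf; have fP : f \in subspace_pred qbF nF1 by exact: mem_set.
apply/cvg_ex; exists (NormedSubspace fP); apply/cvg_ballP => e e0.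
have e20 : 0 < e / 2 by rewrite divr_gt0.
have [n [xnf ne]] : exists n, `|x n - NormedSubspace fP| < e / 2 /\
    n.+1%:R^-1 < e / 2.
  have /cvgr0Pnorm_lt/(_ _ e20) xfe := xf.
  have := near_infty_natSinv_lt (PosNum e20) => ne.
  have [n [/= h1 h2]] := filter_ex (filterI xfe ne).
  exists n; split=> //; apply: le_lt_trans h1; exact: ler_norm.
apply: filterS (Gx n) => y; rewrite -!ball_normE /= => xny.
rewrite (splitr e) -(subrK (x n) (NormedSubspace fP)) -addrA.
apply: le_lt_trans (ler_normD _ _) _; rewrite distrC ltrD//.
exact: lt_trans ne.
Qed.

HB.instance Definition _ :=
  Uniform_isComplete.Build normed_subspace subspace_complete.

Lemma p_norm1_banach : banach F nF.
Proof.
have lv : linear (val : normed_subspace -> V) by move=> a x y.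
pose i : {linear normed_subspace -> V} :=
  HB.pack (val : normed_subspace -> V) (GRing.isLinear.Build _ _ _ _ _ lv).
exists normed_subspace, i; split=> //=.
- exact: val_inj.
- apply/seteqP; split=> f /=; first by move=> [x _ <-]; exact: subspace_valF.
  by move=> Ff; exists (NormedSubspace (mem_set Ff)).
Qed.

End NormedSubspace.

(** * The quasi-Banach space of an l.s.c., subadditive, [p]-homogeneous function *)

Section HomogeneousSpace.
Context {R : realType} {A : completeNormedModType R} (p : R).
Local Notation B := (cdual A).
Context (S : B -> \bar R) (P : {linear B -> B}) (c : R).

Definition finite_part : set B := [set f | (S f < +oo)%E].

(** The root turns [p]-homogeneity of [S] into 1-homogeneity. Where [S] is [+oo], [fine] returns 0,
    so comparisons with [S] are restricted to [finite_part]. *)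
Definition max_norm (f : B) : R := Num.max (fine (S f) `^ p^-1) `|P f|.

Context (p_gt0 : 0 < p) (p_le1 : p <= 1) (S_ge0 : forall f, (0 <= S f)%E)
  (S_lsc : wstar_lsc S) (S_subadditive : subadditive_fun S)
  (S_homogeneous : abs_homogeneous p S) (P_continuous : wstar_continuous P)
  (c_gt0 : 0 < c) (S_coercive : forall f, (S f <= 1)%E -> `|f - P f| <= c).

Let p_neq0 : p != 0. Proof. by rewrite gt_eqF. Qed.

Let fineE f : finite_part f -> S f = (fine (S f))%:E.
Proof. by move=> Ff; rewrite fineK// ge0_fin_numE. Qed.

Lemma max_norm_ge0 f : 0 <= max_norm f.
Proof. by rewrite /max_norm le_max normr_ge0 orbT. Qed.

(** Splits a ball of [max_norm] into two weak* closed conditions, the form in which limits can be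
    taken. *)
Lemma max_norm_le f (t : R) : finite_part f -> 0 <= t ->
  (max_norm f <= t) = (S f <= (t `^ p)%:E)%E && (`|P f| <= t).
Proof.
move=> Ff t0; rewrite /max_norm ge_max; congr (_ && _).
rewrite -[p in RHS]invrK -poweR_le_EFin ?invr_gt0//.
by rewrite [in RHS]fineE// poweR_EFin lee_fin.
Qed.

Lemma finite_part_submod_closed : submod_closed (mem finite_part).
Proof.
have [S0 SZ] := S_homogeneous.
split; first by apply: mem_set; rewrite /finite_part/= S0 ltry.
move=> a f g /set_mem Ff /set_mem Fg; apply: mem_set => /=.
have [->|a0] := eqVneq a 0; first by rewrite scale0r add0r.
apply: le_lt_trans (S_subadditive _ _) _; rewrite SZ//.
by rewrite fineE// (fineE Fg) -EFinM -EFinD ltry.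
Qed.

Let finite_partD f g : finite_part f -> finite_part g -> finite_part (f + g).
Proof.
move=> Ff Fg; have [_ /(_ 1 f g)] := finite_part_submod_closed.
by rewrite scale1r => Ffg; apply/set_mem/Ffg; exact: mem_set.
Qed.

Let finite_partB f g : finite_part f -> finite_part g -> finite_part (f - g).
Proof.
move=> Ff Fg; have [_ /(_ (-1) g f)] := finite_part_submod_closed.
by rewrite scaleN1r addrC => Ffg; apply/set_mem/Ffg; exact: mem_set.
Qed.

Lemma norm_le_max_norm f : finite_part f -> `|f| <= (1 + c) * max_norm f.
Proof.
move=> Ff; have /andP[Sf Pf] : (S f <= (max_norm f `^ p)%:E)%E &&
    (`|P f| <= max_norm f) by rewrite -max_norm_le// max_norm_ge0.
rewrite -[X in `|X|](subrK (P f)) addrC mulrDl mul1r.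
apply: le_trans (ler_normD _ _) _; apply: lerD => //.
rewrite mulrC -ler_pdivrMr//; apply/ler_addgt0Pr => e e0.
(* The extra [e] allows for [max_norm f = 0]: dividing [f] by this positive number brings it into
   [{S <= 1}]. *)
have t0 : 0 < max_norm f + e by rewrite ltr_wpDl// max_norm_ge0.
rewrite ler_pdivrMr// mulrC -ler_pdivrMr//.
have ti0 : (max_norm f + e)^-1 != 0 by rewrite invr_neq0// gt_eqF.
suff /S_coercive : (S ((max_norm f + e)^-1 *: f) <= 1)%E.
  by rewrite linearZ -scalerBr normrZ gtr0_norm ?invr_gt0// mulrC.
rewrite S_homogeneous.2// fineE// -EFinM lee_fin gtr0_norm ?invr_gt0//.
rewrite -powR_inv1 ?(ltW t0)// -powRrM mulN1r powRN mulrC.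
rewrite ler_pdivrMr ?powR_gt0//.
rewrite mul1r; move: Sf; rewrite fineE// lee_fin => /le_trans; apply.
by apply: gt0_ler_powRl; rewrite ?max_norm_ge0// lerDl ltW.
Qed.

Lemma max_norm_p_norm : p_norm p finite_part max_norm.
Proof.
have [S0 SZ] := S_homogeneous.
have nn f : finite_part f ->
    (S f <= (max_norm f `^ p)%:E)%E && (`|P f| <= max_norm f).
  by move=> Ff; rewrite -max_norm_le// max_norm_ge0.
apply: p_norm_intro => //.
- exact: max_norm_ge0.
- by rewrite /max_norm S0 linear0 normr0 /= powR0 ?invr_neq0// maxxx.
- move=> a f Ff a0; rewrite /max_norm linearZ normrZ SZ//.
  rewrite [in LHS]fineE// -EFinM/=.
  by rewrite powRM ?powR_ge0 ?fine_ge0// powRK// maxr_pMr.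
- move=> f Ff f0; apply/eqP; rewrite -normr_le0.
  by apply: le_trans (norm_le_max_norm Ff) _; rewrite f0 mulr0.
- move=> f g Ff Fg.
  have /andP[Sf Pf] := nn f Ff; have /andP[Sg Pg] := nn g Fg.
  pose w := max_norm f `^ p + max_norm g `^ p.
  have w0 : 0 <= w by rewrite addr_ge0// powR_ge0.
  suff le_w : max_norm (f + g) <= w `^ p^-1.
    rewrite -/w -[leRHS](@powRVK _ p)//.
    by apply: gt0_ler_powRl; rewrite ?max_norm_ge0.
  rewrite max_norm_le ?powR_ge0//; last exact: finite_partD.
  rewrite powRVK//; apply/andP; split.
    apply: le_trans (S_subadditive _ _) _; rewrite /w EFinD.
    exact: (leeD Sf Sg).
  (* The norm of [P] obeys the ordinary triangle inequality; subadditivity of the [p]-th power, with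
     [p <= 1], weakens it to the one required. *)
  rewrite linearD; apply: le_trans (ler_normD _ _) _.
  apply: le_trans (lerD Pf Pg) _.
  have n0 : 0 <= max_norm f + max_norm g by rewrite addr_ge0// max_norm_ge0.
  rewrite -[leLHS](@powRK _ p)//.
  apply: gt0_ler_powRl; rewrite ?invr_gt0 ?powR_ge0//.
  by apply: powR_subadditive => //; exact: max_norm_ge0.
Qed.

Lemma max_norm_complete : complete_wrt finite_part max_norm.
Proof.
move=> u Fu uC; have c10 : 0 < 1 + c by rewrite addr_gt0.
have FB m n : finite_part (u m - u n) by exact: finite_partB.
have [f uf] : exists f : B, forall x : A, u n x @[n --> \oo] --> (f x : R^o).
  apply: cdual_cauchy_cvg => e e0.
  have [n0 n0P] := uC (e / (1 + c)) (divr_gt0 e0 c10).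
  exists n0 => m n mn nn; apply: le_trans (norm_le_max_norm (FB m n)) _.
  by rewrite mulrC -ler_pdivlMr// ltW// n0P.
(* For fixed [m], [u m - u n] eventually stays in the ball of radius [e] and converges weak* to
   [u m - f], which therefore satisfies the same weak* closed conditions. *)
have lim_le e : 0 < e -> exists n0 : nat, forall m, (n0 <= m)%N ->
    finite_part (u m - f) /\ max_norm (u m - f) <= e.
  move=> e0; have [n0 n0P] := uC e e0; exists n0 => m mn.
  have nP n : (n0 <= n)%N ->
      (S (u m - u n)%R <= (e `^ p)%:E)%E && (`|P (u m - u n)| <= e).
    by move=> nn; rewrite -max_norm_le ?(ltW e0)// ltW// n0P.
  have ufm (x : A) : (u m - u n : B) x @[n --> \oo] --> ((u m - f : B) x : R^o).
    by apply: cvgB; [exact: cvg_cst | exact: uf].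
  have Sf : (S (u m - f)%R <= (e `^ p)%:E)%E.
    apply: (wstar_closed_cvg (@S_lsc (e `^ p)) ufm).
    by exists n0 => // n /nP /andP[].
  have Pf : `|P (u m - f)| <= e.
    apply: (wstar_closed_cvg (wstar_closed_preimage P_continuous
      (@wstar_closed_ball _ _ e)) ufm).
    by exists n0 => // n /nP /andP[].
  have Ff : finite_part (u m - f) by apply: le_lt_trans Sf _; rewrite ltry.
  by rewrite max_norm_le ?(ltW e0)// Sf Pf.
exists f.
  (* [f] is the difference of [u n0] and [u n0 - f], both in [finite_part]; the tolerance 1 is
     arbitrary. *)
  have [n0 /(_ n0 (leqnn _)) [Ff _]] := lim_le 1 ltr01.
  by rewrite -(subKr (u n0) f); exact: finite_partB.
apply/cvgr0Pnorm_le => e e0; have [n0 n0P] := lim_le e e0.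
exists n0 => // n /= /n0P [_].
by rewrite ger0_norm// max_norm_ge0.
Qed.

Lemma max_norm_quasi_banach : quasi_banach finite_part max_norm.
Proof.
split; [exact: finite_part_submod_closed | by case: max_norm_p_norm |].
exact: max_norm_complete.
Qed.

End HomogeneousSpace.

(** The map [T = Id - P] vanishes on [N], so [|T f| = |T (f + g)| <= M * |f + g|] for all [g] in
    [N]; the infimum over [g] turns coercivity into the bound [M * b]. *)
Lemma wstar_projector_coercive (R : realType) (A : completeNormedModType R)
    (N : set (cdual A)) (P : cdual A -> cdual A) (K : cdual A -> \bar R) :
  wstar_projector N P -> coercive_modulo N K ->
  forall a : R, exists2 c : R, 0 < c & wstar_closed [set f | `|f - P f| <= c] /\
    forall f, (K f <= a%:E)%E -> `|f - P f| <= c.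
Proof.
move=> [lP cP PP PN] coK a; have [b b0 bP] := coK a.
pose T (f : cdual A) := f - P f.
have lT : linear T.
  by move=> x f g; rewrite /T lP opprD addrACA scalerBr.
pose TL : {linear cdual A -> cdual A} :=
  HB.pack T (GRing.isLinear.Build _ _ _ _ T lT).
have cT : wstar_continuous T.
  apply/wstar_continuousP => x f.
  have -> : (fun g => T g x) = (fun g : cdual A => g x - P g x :> R^o) by [].
  have FF := nbhs_filter (f : wstar A).
  apply: cvgB; first exact: wstar_eval_continuous.
  exact: (wstar_continuousP P).1.
have [M M0 MP] := @wstar_continuous_linear_bounded R A TL cT.
exists (M * b); first by rewrite mulr_gt0.
split; first exact: (wstar_closed_preimage cT (@wstar_closed_ball _ _ (M * b))).
move=> f /bP fb; rewrite mulrC -ler_pdivrMr//; apply: le_trans fb.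
apply: lb_le_inf.
  by exists `|f + P 0|, (P 0) => //; rewrite -PN; exists 0.
move=> _ [g + <-]; rewrite -PN => -[h _ <-].
rewrite ler_pdivrMr// mulrC; have := MP (f + P h); rewrite [TL _](linearD TL).
rewrite (_ : TL (P h) = 0) ?addr0//.
by rewrite -[LHS]/(P h - P (P h)) PP subrr.
Qed.

(** * Reduction of the representation cost to the regularization of [Q] *)

Theorem corollary3p9 (R : realType) (A : completeNormedModType R)
    (sepA : separable A)
    (Theta : Type) (model : Theta -> cdual A)
    (C : Theta -> R) (C_ge0 : forall t, 0 <= C t)
    (q p : R) (q_gt0 : 0 < q) (p_gt0 : 0 < p) (p_le1 : p <= 1)
    (Q : cdual A -> \bar R) (Q_ge0 : forall f, (0 <= Q f)%E)
    (Q_subadditive : subadditive_fun Q) (Q_homogeneous : abs_homogeneous p Q)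
    (costE : forall f, repr_cost model C f = (Q f `^ q)%E)
    (N : set (cdual A)) (N_ker : N `<=` [set f | repr_cost model C f = 0%E])
    (N_compl : wstar_complemented N)
    (cost_coercive : coercive_modulo N (repr_cost model C))
    (P : cdual A -> cdual A) (P_proj : wstar_projector N P) :
  let r := lsc_reg (repr_cost model C) in
  let F := [set f | (r f < +oo)%E] in
  let nF := fun f => Num.max (fine (r f `^ (p * q)^-1)%E) `|P f| in
  [/\ quasi_banach F nF, p_norm p F nF & p = 1 -> banach F nF].
Proof.
move=> r F nF; pose S := lsc_reg Q.
have [lP cP _ _] := P_proj.
pose PL : {linear cdual A -> cdual A} :=
  HB.pack P (GRing.isLinear.Build _ _ _ _ P lP).
have rE f : r f = (S f `^ q)%E.
  rewrite /r (_ : repr_cost model C = fun f => Q f `^ q)%E; last exact/funext.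
  by rewrite lsc_reg_poweR.
have FE : F = finite_part S.
  apply/seteqP; split=> f; rewrite /F/= rE; last exact: poweR_lty.
  by apply: lty_poweRy; rewrite gt_eqF.
have nFE : nF = max_norm p S PL.
  apply/funext => f; rewrite /nF /max_norm rE -poweRrM fine_poweR.
  by rewrite invfM mulrCA mulfV ?gt_eqF// mulr1.
have S_ge0 := lsc_reg_ge0 Q_ge0.
(* The cost level [2 ^ q] is level 2 of [Q]. A level above 1 is taken because [lsc_reg_sublevel]
   asks for a strict inequality, here [S f < 2], which [S f <= 1] provides. *)
have [c c0 [Dc Qc]] := wstar_projector_coercive P_proj cost_coercive (2 `^ q).
have S_coercive f : (S f <= 1)%E -> `|f - PL f| <= c.
  move=> Sf; apply: (@lsc_reg_sublevel _ _ Q _ 2 f _ Q_ge0 Dc) => // [g Qg|].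
    apply: Qc; rewrite costE -poweR_EFin; apply: gt0_ler_poweR => //.
    - exact: ltW.
    - by rewrite in_itv /= Q_ge0 leey.
    - by rewrite in_itv /= lee_fin ler0n leey.
  by apply: le_lt_trans Sf _; rewrite lte_fin ltr1n.
have S_lsc : wstar_lsc S by exact: lsc_reg_lsc.
have S_sub : subadditive_fun S by exact: lsc_reg_subadditive.
have S_hom : abs_homogeneous p S by exact: lsc_reg_homogeneous.
have pn : p_norm p F nF.
  by rewrite FE nFE; exact: (@max_norm_p_norm _ _ _ _ _ c).
have qb : quasi_banach F nF.
  by rewrite FE nFE; exact: (@max_norm_quasi_banach _ _ _ _ _ c).
by split=> // p1; apply: p_norm1_banach; rewrite -?p1.
Qed.
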